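(* Let $k,m$ be positive integers with $k<m<2k$, and for $n,r,s\ge 0$ let $d_k(m,n,r,s)$ denote the number of tilings of an $m\times n\times k$ cuboid with $k\times k\times 1$ bricks which contain precisely $r$ bricks parallel to the $yz$-plane and $s$ bricks parallel to the $xy$-plane. Then, as formal power series in $x,y,z$, $$\sum_{n,r,s\geq 0}d_k(m,n,r,s)x^ny^rz^s=\frac{(1-x^k-x^kz^k)^{k-1}}{\left(1-x^k-(m-k+1)x^kz^k\right)(1-x^k-x^kz^k)^{k-1}-(m-k+1)x^ky^k}.$$
   Context: The cuboid is placed in the positive octant with a corner at the origin and with its sides of length $n$, $m$ and $k$ along the $x$-, $y$- and $z$-axes respectively, and is divided into unit cubical cells. A tiling with $k\times k\times 1$ bricks is a partition of its cells into bricks, each of which is an axis-parallel box of cells with side lengths $k,k,1$ in some order; all three axis-parallel orientations are allowed. A brick is parallel to a coordinate plane if its $k\times k$ faces are parallel to that plane (so a brick parallel to the $yz$-plane has side length $1$ in the $x$-direction, and a brick parallel to the $xy$-plane has side length $1$ in the $z$-direction). Tilings are counted as distinct configurations (not up to symmetry). Convention: for $n=0$ there is exactly one tiling, the empty one, which contains no bricks. *)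

(* Defs.v *)
From HB Require Import structures.
From mathcomp Require Import all_boot all_order all_algebra.
From mathcomp Require Import boolp.

Set Implicit Arguments.
Unset Strict Implicit.
Unset Printing Implicit Defensive.

Import GRing.Theory.
Local Open Scope ring_scope.

(* Univariate formal power series R[[X]], with the Cauchy product.  The       *)
(* invertible series are those whose constant coefficient is a unit of R; as  *)
(* everywhere in the ring hierarchy, f^-1 = f when f is not invertible.       *)

Record fps (R : Type) := Fps { fpscoef : nat -> R }.
Notation "{ 'fps' R }" := (fps R) (at level 0, format "{ 'fps'  R }").

HB.instance Definition _ (R : Type) := gen_eqMixin {fps R}.
HB.instance Definition _ (R : Type) := gen_choiceMixin {fps R}.

Lemma fpsP (R : Type) (f g : {fps R}) :
  (forall n, fpscoef f n = fpscoef g n) -> f = g.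
Proof. by case: f g => [f] [g] /= fg; congr Fps; apply: funext. Qed.

(* The operations are locked, as for {poly R}; the coefficients are given by  *)
(* the coef_fps lemmas below.                                                 *)

HB.lock Definition fpsC (R : comUnitRingType) (c : R) : {fps R} :=
  Fps (fun n => if n == 0%N then c else 0).
Canonical fpsC_unlockable := Unlockable fpsC.unlock.

HB.lock Definition fpsX (R : comUnitRingType) : {fps R} :=
  Fps (fun n => (n == 1%N)%:R).
Canonical fpsX_unlockable := Unlockable fpsX.unlock.
Arguments fpsX {R}.

HB.lock Definition fps_opp (R : comUnitRingType) (f : {fps R}) : {fps R} :=
  Fps (fun n => - fpscoef f n).
Canonical fps_opp_unlockable := Unlockable fps_opp.unlock.

HB.lock Definition fps_add (R : comUnitRingType) (f g : {fps R}) : {fps R} :=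
  Fps (fun n => fpscoef f n + fpscoef g n).
Canonical fps_add_unlockable := Unlockable fps_add.unlock.

HB.lock Definition fps_mul (R : comUnitRingType) (f g : {fps R}) : {fps R} :=
  Fps (fun n => \sum_(i < n.+1) fpscoef f i * fpscoef g (n - i)).
Canonical fps_mul_unlockable := Unlockable fps_mul.unlock.

Definition fps_unit (R : comUnitRingType) : pred {fps R} :=
  [pred f | fpscoef f 0%N \is a GRing.unit].

(* The first n coefficients of 1 / f, obtained from the recurrence            *)
(*   g_n = f_0^-1 (delta_(n,0) - \sum_(i < n) f_(n-i) g_i).                   *)
Fixpoint fps_inv_seq (R : comUnitRingType) (f : {fps R}) (n : nat) : seq R :=
  if n is p.+1 then
    let s := fps_inv_seq f p in
    rcons s ((fpscoef f 0%N)^-1 *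
             ((p == 0%N)%:R - \sum_(i < p) fpscoef f (p - i) * s`_i))
  else [::].

HB.lock Definition fps_inv (R : comUnitRingType) (f : {fps R}) : {fps R} :=
  if fps_unit f then Fps (fun n => (fps_inv_seq f n.+1)`_n) else f.
Canonical fps_inv_unlockable := Unlockable fps_inv.unlock.

Section FpsRing.
Variable R : comUnitRingType.
Implicit Types f g h : {fps R}.

Lemma coef_fpsC c n : fpscoef (fpsC c : {fps R}) n = if n == 0%N then c else 0.
Proof. by rewrite unlock. Qed.

Lemma coef_fpsX n : fpscoef (fpsX : {fps R}) n = (n == 1%N)%:R.
Proof. by rewrite unlock. Qed.

Let coef_opp f n : fpscoef (fps_opp f) n = - fpscoef f n.
Proof. by rewrite unlock. Qed.

Let coef_add f g n : fpscoef (fps_add f g) n = fpscoef f n + fpscoef g n.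
Proof. by rewrite unlock. Qed.

Let coef_mul f g n :
  fpscoef (fps_mul f g) n = \sum_(i < n.+1) fpscoef f i * fpscoef g (n - i).
Proof. by rewrite unlock. Qed.

Fact fps_addA : associative (@fps_add R).
Proof. by move=> f g h; apply: fpsP => n; rewrite !coef_add addrA. Qed.
Fact fps_addC : commutative (@fps_add R).
Proof. by move=> f g; apply: fpsP => n; rewrite !coef_add addrC. Qed.
Fact fps_add0 : left_id (fpsC 0) (@fps_add R).
Proof.
by move=> f; apply: fpsP => n; rewrite coef_add coef_fpsC if_same add0r.
Qed.
Fact fps_addN : left_inverse (fpsC 0) (@fps_opp R) (@fps_add R).
Proof.
by move=> f; apply: fpsP => n; rewrite coef_add coef_opp coef_fpsC if_same addNr.
Qed.

HB.instance Definition _ := GRing.isZmodule.Build {fps R}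
  fps_addA fps_addC fps_add0 fps_addN.

Let trunc N f : {poly R} := \poly_(i < N.+1) fpscoef f i.

Let coef_trunc N f i : (i <= N)%N -> (trunc N f)`_i = fpscoef f i.
Proof. by move=> leiN; rewrite coef_poly ltnS leiN. Qed.

Let coef_mul_poly n f g (p q : {poly R}) :
    (forall i, (i <= n)%N -> p`_i = fpscoef f i) ->
    (forall i, (i <= n)%N -> q`_i = fpscoef g i) ->
  forall i, (i <= n)%N -> (p * q)`_i = fpscoef (fps_mul f g) i.
Proof.
move=> fp gq i lein; rewrite coefM coef_mul; apply: eq_bigr => j _.
rewrite fp ?gq //; first exact: leq_trans (leq_subr _ _) lein.
by apply: leq_trans lein; rewrite -ltnS.
Qed.

Fact fps_mulA : associative (@fps_mul R).
Proof.
move=> f g h; apply: fpsP => n.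
have c := @coef_trunc n; have m := @coef_mul_poly n.
rewrite -(m _ _ _ _ (c f) (m _ _ _ _ (c g) (c h))) // mulrA.
by rewrite -(m _ _ _ _ (m _ _ _ _ (c f) (c g)) (c h)).
Qed.

Fact fps_mulC : commutative (@fps_mul R).
Proof.
move=> f g; apply: fpsP => n.
have c := @coef_trunc n; have m := @coef_mul_poly n.
by rewrite -(m _ _ _ _ (c f) (c g)) // mulrC -(m _ _ _ _ (c g) (c f)).
Qed.

Fact fps_mul1 : left_id (fpsC 1) (@fps_mul R).
Proof.
move=> f; apply: fpsP => n; rewrite coef_mul big_ord_recl coef_fpsC mul1r subn0.
by rewrite big1 ?addr0 // => i _; rewrite coef_fpsC mul0r.
Qed.

Fact fps_mulDl : left_distributive (@fps_mul R) +%R.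
Proof.
move=> f g h; apply: fpsP => n; rewrite [RHS]coef_add !coef_mul -big_split.
by apply: eq_bigr => i _; rewrite [fpscoef (f + g) _]coef_add mulrDl.
Qed.

Fact fps_one_neq0 : fpsC 1 != 0 :> {fps R}.
Proof.
apply/eqP => /(congr1 (fun f => fpscoef f 0%N)) /eqP.
by rewrite !coef_fpsC oner_eq0.
Qed.

HB.instance Definition _ := GRing.Zmodule_isComNzRing.Build {fps R}
  fps_mulA fps_mulC fps_mul1 fps_mulDl fps_one_neq0.

Lemma coef_fps0 n : fpscoef (0 : {fps R}) n = 0.
Proof. by rewrite coef_fpsC if_same. Qed.

Lemma coef_fps1 n : fpscoef (1 : {fps R}) n = (n == 0%N)%:R.
Proof. by rewrite coef_fpsC; case: n. Qed.

Lemma coef_fpsN f n : fpscoef (- f) n = - fpscoef f n.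
Proof. exact: coef_opp. Qed.

Lemma coef_fpsD f g n : fpscoef (f + g) n = fpscoef f n + fpscoef g n.
Proof. exact: coef_add. Qed.

Lemma coef_fpsM f g n :
  fpscoef (f * g) n = \sum_(i < n.+1) fpscoef f i * fpscoef g (n - i).
Proof. exact: coef_mul. Qed.

Let size_inv_seq f n : size (fps_inv_seq f n) = n.
Proof. by elim: n => //= n IHn; rewrite size_rcons IHn. Qed.

Let nth_inv_seq f n i :
  (i < n)%N -> (fps_inv_seq f n)`_i = (fps_inv_seq f i.+1)`_i.
Proof.
elim: n => // n IHn; rewrite ltnS leq_eqVlt => /predU1P[-> //|ltin].
by rewrite [LHS]nth_rcons size_inv_seq ltin IHn.
Qed.

Fact fps_mulV : {in @fps_unit R, left_inverse 1 (@fps_inv R) *%R}.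
Proof.
move=> f fU; have f0U : fpscoef f 0%N \is a GRing.unit := fU.
have -> : fps_inv f = Fps (fun n => (fps_inv_seq f n.+1)`_n).
  by rewrite unlock /fps_unit /= f0U.
apply: fpsP => n; rewrite coef_fps1 mulrC.
have -> g : fpscoef (f * g) n =
    \sum_(i < n.+1) fpscoef f (n - i) * fpscoef g i.
  by rewrite mulrC coef_fpsM; apply: eq_bigr => i _; rewrite mulrC.
rewrite big_ord_recr /= subnn nth_rcons size_inv_seq ltnn eqxx mulVKr //.
set u := \sum_(i < n) _; set v := \sum_(i < n) _.
suff -> : u = v by rewrite addrC subrK.
by apply: eq_bigr => i _; rewrite [in RHS]nth_inv_seq.
Qed.

Fact fps_unitPl f g : g * f = 1 -> fps_unit f.
Proof.
move/(congr1 (fun h => fpscoef h 0%N)); rewrite coef_fpsM big_ord1 coef_fps1.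
by move=> gf1; apply/unitrPr; exists (fpscoef g 0%N); rewrite mulrC.
Qed.

Fact fps_inv_out : {in [predC @fps_unit R], @fps_inv R =1 id}.
Proof. by move=> f /negP fU; rewrite unlock; case: ifP => // /fU. Qed.

HB.instance Definition _ := GRing.ComNzRing_hasMulInverse.Build {fps R}
  fps_mulV fps_unitPl fps_inv_out.

Lemma fps_unitE f : (f \is a GRing.unit) = (fpscoef f 0%N \is a GRing.unit).
Proof. by []. Qed.

End FpsRing.

(* Z[[x, y, z]], encoded as Z[[z]][[y]][[x]]: the coefficient of x^n y^r z^s  *)
(* in F is fpscoef (fpscoef (fpscoef F n) r) s.                               *)
Notation fps3 := {fps {fps {fps int}}}.

Definition fps3_of (a : nat -> nat -> nat -> int) : fps3 :=
  Fps (fun n => Fps (fun r => Fps (fun s => a n r s))).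

Definition varx : fps3 := fpsX.
Definition vary : fps3 := fpsC fpsX.
Definition varz : fps3 := fpsC (fpsC fpsX).

(* The cuboid with side lengths nx, ny, nz along the three axes; the triple   *)
(* (a, b, c) stands for the unit cell [a, a+1] x [b, b+1] x [c, c+1].         *)

Definition cell (nx ny nz : nat) := ('I_nx * 'I_ny * 'I_nz)%type.

Section Tilings.
Variables nx ny nz : nat.
Implicit Types (u v : cell nx ny nz) (B : {set cell nx ny nz}).
Implicit Types P : {set {set cell nx ny nz}}.

(* B is a box of side lengths p, q, r > 0 contained in the cuboid, with       *)
(* lowest cell v.                                                             *)
Definition is_box (p q r : nat) B : bool :=
  [exists v : cell nx ny nz,
    [&& (v.1.1 + p <= nx)%N, (v.1.2 + q <= ny)%N, (v.2 + r <= nz)%N &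
      B == [set u : cell nx ny nz |
              [&& (v.1.1 <= u.1.1 < v.1.1 + p)%N,
                  (v.1.2 <= u.1.2 < v.1.2 + q)%N &
                  (v.2 <= u.2 < v.2 + r)%N]]]].

Definition parallel_yz (k : nat) B := is_box 1 k k B.
Definition parallel_xz (k : nat) B := is_box k 1 k B.
Definition parallel_xy (k : nat) B := is_box k k 1 B.

Definition is_brick (k : nat) B :=
  [|| parallel_yz k B, parallel_xz k B | parallel_xy k B].

Definition is_tiling (k : nat) P :=
  partition P [set: cell nx ny nz] && [forall B in P, is_brick k B].

Definition tilings (k r s : nat) : {set {set {set cell nx ny nz}}} :=
  [set P | [&& is_tiling k P,
               #|[set B in P | parallel_yz k B]| == r &
               #|[set B in P | parallel_xy k B]| == s]].

End Tilings.

Definition num_tilings (k m n r s : nat) : nat := #|tilings n m k k r s|.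

(* Main.v *)
Require Import Defs.
From mathcomp Require Import all_boot all_order all_algebra.
From mathcomp Require Import zify ring.

Set Implicit Arguments.
Unset Strict Implicit.
Unset Printing Implicit Defensive.

Import GRing.Theory.
Local Open Scope ring_scope.

(* Fill the cuboid along the x-axis, always covering a cell that is foremost
   among the empty ones.  Since all bricks meeting it have their back face in
   the same plane, the empty part is at each stage described by a height
   profile.  Because m < 2k, no k consecutive rows are left beside a brick of
   width k, and a run of fewer than k rows at the minimal level must be filled
   by bricks parallel to the xz-plane; a brick parallel to the xy-plane forces
   the whole stack of k of them.  Up to such forced moves the only profiles are
   the flat ones and those in which one strip of k rows lags d < k units behind the
   other rows.  With A(x) and E_d(x) their generating functions (E_0 = A),
   and c = m - k + 1 the number of positions of the strip,
     E_d = y E_(d-1) + x^k (1 + z^k) E_d                    (0 < d < k)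
     A = 1 + x^k (1 + c z^k) A + c x^k y E_(k-1),
   and eliminating the E_d gives the formula. *)

(** * Weighted sums over set partitions *)

Section WeightedPartitions.
Variables (T : finType) (R : comNzRingType) (w : {set T} -> R).

Definition partition_sum (D : {set T}) : R :=
  \sum_(P | partition P D) \prod_(B in P) w B.

Lemma partition_sum0 : partition_sum set0 = 1.
Proof.
rewrite /partition_sum (big_pred1 set0); first by rewrite big_set0.
by move=> P; rewrite /= partition_set0.
Qed.

(** Sort the partitions by the block [B] containing [c]; deleting [B] is a bijection from those with
    this block onto the partitions of [D :\: B]. *)
Lemma partition_sum_rec (D : {set T}) c : c \in D ->
  partition_sum D =
    \sum_(B : {set T} | (c \in B) && (B \subset D))
      w B * partition_sum (D :\: B).
Proof.
move=> cD; rewrite /partition_sum.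
rewrite (partition_big (fun P => pblock P c)
          (fun B : {set T} => (c \in B) && (B \subset D)))
  => [|P partP]; last first.
  have cP : c \in cover P by rewrite (cover_partition partP).
  by rewrite mem_pblock cP (partitionS partP) ?pblock_mem.
apply: eq_bigr => B /andP[cB sBD]; rewrite big_distrr /=.
rewrite (reindex_onto (fun Q : {set {set T}} => B |: Q) (fun P => P :\ B));
  last first.
  move=> P /andP[partP /eqP <-]; rewrite setD1K // pblock_mem //.
  by rewrite (cover_partition partP).
have B_neq0 : B != set0 by apply/set0Pn; exists c.
have cDB : c \notin D :\: B by rewrite inE cB.
have notin Q : partition Q (D :\: B) -> B \notin Q.
  by move=> partQ; apply: contra cDB => /(partitionS partQ)/subsetP; apply.
apply: eq_big => [Q|Q /andP[_ /eqP QE]]; last first.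
  by rewrite big_setU1 //= -QE !inE eqxx.
apply/andP/idP => [[/andP[partP _] /eqP <-]|partQ].
  by rewrite partitionD1 // setU11.
have partP : partition (B |: Q) D.
  have -> : D = B :|: (D :\: B).
    by rewrite -{1}(setID D B) (setIidPr sBD).
  by rewrite partitionU1 // disjoints_subset setCD subsetUr.
split; last by rewrite setU1K // notin.
rewrite partP /=; apply/eqP/def_pblock; rewrite ?setU11 //.
exact: partition_trivIset partP.
Qed.

End WeightedPartitions.

(** * Boxes and height profiles *)

Section Boxes.
Variables nx ny nz : nat.
Implicit Types (B : {set cell nx ny nz}) (f : nat -> nat -> nat).

Definition box (x y z p q r : nat) : {set cell nx ny nz} :=
  [set u : cell nx ny nz | [&& (x <= u.1.1 < x + p)%N, (y <= u.1.2 < y + q)%N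
             & (z <= u.2 < z + r)%N]].

(** Corners become plain naturals; positive side lengths put the lowest cell inside the cuboid. *)
Lemma is_boxP p q r B : (0 < p)%N -> (0 < q)%N -> (0 < r)%N ->
  reflect (exists x y z, [/\ (x + p <= nx)%N, (y + q <= ny)%N,
                             (z + r <= nz)%N & B = box x y z p q r])
          (is_box p q r B).
Proof.
move=> p0 q0 r0; apply: (iffP existsP) => [[v /and4P[h1 h2 h3 /eqP ->]]|].
  by exists v.1.1, v.1.2, v.2; split.
move=> [x [y [z [h1 h2 h3 ->]]]].
have hx : (x < nx)%N by lia.
have hy : (y < ny)%N by lia.
have hz : (z < nz)%N by lia.
by exists (Ordinal hx, Ordinal hy, Ordinal hz); rewrite /= h1 h2 h3 /=.
Qed.

(* A frontier [f] is the height profile, along the x-axis, of an already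
   filled part of the cuboid; [beyond f] is what remains to be tiled. *)
Definition beyond f : {set cell nx ny nz} :=
  [set u : cell nx ny nz | (f u.1.2 u.2 <= u.1.1)%N].

Definition push f (y z p q r : nat) : nat -> nat -> nat :=
  fun y' z' => if (y <= y' < y + q)%N && (z <= z' < z + r)%N
               then (f y' z' + p)%N else f y' z'.

Definition flat_on f (x y z q r : nat) :=
  forall y' z', (y <= y' < y + q)%N -> (z <= z' < z + r)%N -> f y' z' = x.

Definition above f (x : nat) :=
  forall y z, (y < ny)%N -> (z < nz)%N -> (x <= f y z)%N.

Lemma eq_beyond f g :
  (forall y z, (y < ny)%N -> (z < nz)%N -> f y z = g y z) ->
  beyond f = beyond g.
Proof. by move=> fg; apply/setP=> u; rewrite !inE fg. Qed.

Lemma beyondD_box f x y z p q r : flat_on f x y z q r ->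
  beyond f :\: box x y z p q r = beyond (push f y z p q r).
Proof.
move=> ffl; apply/setP=> u; rewrite !inE /push.
have := ffl u.1.2 u.2.
case: (y <= _ < _)%N; case: (z <= _ < _)%N; rewrite /= ?andbF ?andbT //=.
by move=> /(_ isT isT) ->; lia.
Qed.

Lemma box_beyond f x y z p q r : (0 < p)%N -> above f x -> (x + p <= nx)%N ->
  flat_on f x y z q r -> box x y z p q r \subset beyond f.
Proof.
move=> p0 fx xp ffl; apply/subsetP=> u; rewrite !inE => /and3P[ux uy uz].
by rewrite ffl //; lia.
Qed.

Section BoxSum.
Variables (R : comNzRingType) (G : {set cell nx ny nz} -> R).
Variables (f : nat -> nat -> nat) (p q r : nat) (c : cell nx ny nz).
Hypotheses (p0 : (0 < p)%N) (q0 : (0 < q)%N) (r0 : (0 < r)%N).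
Hypothesis fx : above f c.1.1.

Let boxes B := [&& c \in B, B \subset beyond f & is_box p q r B].

(** As no height lies below that of [c], a box of empty cells through [c] has its back face exactly
    at the level of [c], and the profile is flat behind it. Only the position in the y- and
    z-directions remains free. *)
Let boxesP B : reflect
  (exists y z, [/\ [&& (c.1.1 + p <= nx)%N, (y + q <= ny)%N & (z + r <= nz)%N],
     (y <= c.1.2 < y + q)%N, (z <= c.2 < z + r)%N, flat_on f c.1.1 y z q r &
     B = box c.1.1 y z p q r])
  (boxes B).
Proof.
apply: (iffP and3P) => [[cB sB /is_boxP[] // x [y [z [hx hy hz BE]]]]|];
  last first.
  move=> [y [z [/and3P[h1 h2 h3] h4 h5 ffl ->]]]; split.
  - by rewrite inE h4 h5; lia.
  - exact: box_beyond.
  - by apply/is_boxP => //; exists c.1.1, y, z.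
move: cB; rewrite BE inE => /and3P[cx cy cz].
(* The back cells of the box are empty, which bounds the profile above by [x]; minimality of [c]
   bounds it below. *)
have low y' z' : (y <= y' < y + q)%N -> (z <= z' < z + r)%N ->
    (f y' z' <= x)%N /\ (c.1.1 <= f y' z')%N.
  move=> y'y z'z.
  have y'n : (y' < ny)%N by lia.
  have z'n : (z' < nz)%N by lia.
  have xn : (x < nx)%N by lia.
  have := subsetP sB (Ordinal xn, Ordinal y'n, Ordinal z'n).
  rewrite BE !inE /= y'y z'z !andbT => lowx.
  by split; [apply: lowx; lia | apply: fx].
have xE : x = c.1.1 by have [] := low _ _ cy cz; lia.
exists y, z; subst x; split; rewrite ?hx ?hy // => y' z' y'y z'z.
by have [] := low _ _ y'y z'z; lia.
Qed.

Lemma sum_boxes1 y z :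
    (c.1.1 + p <= nx)%N -> (y + q <= ny)%N -> (z + r <= nz)%N ->
    (y <= c.1.2 < y + q)%N -> (z <= c.2 < z + r)%N -> flat_on f c.1.1 y z q r ->
    (forall y' z', (y' + q <= ny)%N -> (z' + r <= nz)%N ->
      (y' <= c.1.2 < y' + q)%N -> (z' <= c.2 < z' + r)%N ->
      flat_on f c.1.1 y' z' q r -> y' = y /\ z' = z) ->
  \sum_(B | boxes B) G (beyond f :\: B) = G (beyond (push f y z p q r)).
Proof.
move=> h1 h2 h3 h4 h5 ffl uniq; rewrite (big_pred1 (box c.1.1 y z p q r)).
  by rewrite (beyondD_box _ ffl).
move=> B; apply/boxesP/eqP => [[y' [z' [/and3P[g1 g2 g3] g4 g5 gfl ->]]]|->].
  by have [-> ->] := uniq _ _ g2 g3 g4 g5 gfl.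
by exists y, z; rewrite h1 h2 h3.
Qed.

Lemma sum_boxes0 :
    (forall y z, (c.1.1 + p <= nx)%N -> (y + q <= ny)%N -> (z + r <= nz)%N ->
      (y <= c.1.2 < y + q)%N -> (z <= c.2 < z + r)%N ->
      ~ flat_on f c.1.1 y z q r) ->
  \sum_(B | boxes B) G (beyond f :\: B) = 0.
Proof.
move=> none; apply: big_pred0 => B; apply/boxesP => -[y [z []]].
by move=> /and3P[h1 h2 h3] h4 h5 ffl _; apply: none ffl.
Qed.

End BoxSum.
End Boxes.

(** * Recurrences between tiling sums of profiles *)

Section Frontiers.
Variables (n m k : nat) (R : comNzRingType) (wy wz : R).
Hypotheses (lt_1k : (1 < k)%N) (lt_km : (k < m)%N) (lt_m2k : (m < 2 * k)%N).

(** A sum of three indicators, so that the recursion splits by orientation at once; a set that is no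
    brick has weight 0. *)
Definition brick_weight (B : {set cell n m k}) : R :=
  wy *+ parallel_yz k B + (parallel_xz k B)%:R + wz *+ parallel_xy k B.

Let W f := partition_sum brick_weight (beyond n m k f).

Let boxes f (c : cell n m k) p q r (B : {set cell n m k}) :=
  [&& c \in B, B \subset beyond n m k f & is_box p q r B].

Let W_rec f (c : cell n m k) : c \in beyond n m k f ->
  W f = wy * (\sum_(B | boxes f c 1 k k B)
                partition_sum brick_weight (beyond n m k f :\: B))
        + \sum_(B | boxes f c k 1 k B)
                partition_sum brick_weight (beyond n m k f :\: B)
        + wz * (\sum_(B | boxes f c k k 1 B)
                partition_sum brick_weight (beyond n m k f :\: B)).
Proof.
move=> cf; rewrite /W (partition_sum_rec _ cf) /boxes.
have E p q r F : \sum_(B | boxes f c p q r B) F B =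
    \sum_(B : {set cell n m k} | (c \in B) && (B \subset beyond n m k f))
      F B *+ is_box p q r B :> R.
  under [RHS]eq_bigr do rewrite mulrb; rewrite -big_mkcondr.
  by apply: eq_bigl => B; apply: andbA.
rewrite !E !big_distrr /= -!big_split /=.
apply: eq_bigr => B _.
rewrite /brick_weight /parallel_yz /parallel_xz /parallel_xy.
by do 3 case: is_box; rewrite /= ?mulr0n ?mulr1n; ring.
Qed.

Let eqW f g : (forall y z, (y < m)%N -> (z < k)%N -> f y z = g y z) ->
  W f = W g.
Proof. by move=> fg; rewrite /W (eq_beyond n fg). Qed.

(** Heights do not depend on z: once forced stacks are completed, only such profiles recur. *)
Definition tiling_sum (g : nat -> nat) : R :=
  partition_sum brick_weight (beyond n m k (fun y _ => g y)).

Definition raise (g : nat -> nat) (y p q : nat) : nat -> nat :=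
  fun y' => if (y <= y' < y + q)%N then (g y' + p)%N else g y'.

Lemma eq_tiling_sum g h : (forall y, (y < m)%N -> g y = h y) ->
  tiling_sum g = tiling_sum h.
Proof. by move=> gh; apply: eqW => y z ym _; apply: gh. Qed.

Lemma tiling_sum_full g : (forall y, (y < m)%N -> (n <= g y)%N) ->
  tiling_sum g = 1.
Proof.
move=> gn; rewrite /tiling_sum (_ : beyond n m k _ = set0) ?partition_sum0 //.
apply/setP => u; rewrite !inE; apply/negbTE; rewrite -ltnNge.
exact: leq_trans (gn _ _).
Qed.

Section Step.
Variables (g : nat -> nat) (x y : nat).
Hypotheses (lt_xn : (x < n)%N) (lt_ym : (y < m)%N) (gy : g y = x).
Hypothesis ge_x : forall y', (y' < m)%N -> (x <= g y')%N.
Hypothesis gt_x : (0 < y)%N -> (x < g y.-1)%N.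

Let flat := forall y', (y <= y' < y + k)%N -> g y' = x.

(** Row [y] begins a run at the minimal level, and row [y - 1] is higher, so a flat base containing
    row [y] cannot start further left. *)
Let leftmost f y' z' q r z : (y' <= y < y' + q)%N -> (z' <= z < z' + r)%N ->
  (forall y, f y z = g y) -> flat_on f x y' z' q r -> y' = y.
Proof.
move=> y'y z'z fg ffl; case: (ltnP y' y) => [lt_y'y|]; last by lia.
have gx : g y.-1 = x by rewrite -(fg y.-1); apply: ffl; lia.
by have := gt_x; lia.
Qed.

(* The cells above the first square brick of a stack can only be reached by
   further bricks of the same stack. *)
Let stack t : (0 < t <= k)%N -> (x + k <= n)%N -> (y + k <= m)%N -> flat ->
  W (push (fun y _ => g y) y 0 k k t) =
    wz ^+ (k - t) * tiling_sum (raise g y k k).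
Proof.
move=> tk xk yk fl; move kt: (k - t)%N => d.
elim: d t tk kt => [|d IHd] t tk kt.
  rewrite mul1r; apply: eqW => y' z' _ z'k; rewrite /push /raise.
  by case: ifP; case: ifP => //; lia.
have zk : (t < k)%N by lia.
pose f := push (fun y _ => g y) y 0 k k t.
pose c : cell n m k := (Ordinal lt_xn, Ordinal lt_ym, Ordinal zk).
have ft y' : f y' t = g y' by rewrite /f /push; case: ifP => //; lia.
have f0 : f y 0 = (x + k)%N by rewrite /f /push gy ifT //; lia.
have cf : c \in beyond n m k f by rewrite inE /= ft gy.
have fx : above m k f x.
  move=> y' z' y'm _; have := ge_x y'm; rewrite /f /push; case: ifP; lia.
rewrite -/f (W_rec cf).
(* The other two orientations extend over all of the z-range and would meet [z = 0], where row [y]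
   already stands at [x + k]. *)
rewrite [X in wy * X]sum_boxes0 /=; [|lia|lia|lia|done|]; last first.
  move=> y' z' _ _ z'k y'y z'z ffl.
  by have := ffl y 0; rewrite f0; lia.
rewrite [X in _ + X + _]sum_boxes0 /=; [|lia|lia|lia|done|]; last first.
  move=> y' z' _ _ z'k y'y z'z ffl.
  by have := ffl y 0; rewrite f0; lia.
rewrite (sum_boxes1 _ _ _ _ _ (y := y) (z := t)) /=; try lia; try done.
- rewrite exprS -mulrA -(IHd t.+1); [|lia|lia].
  rewrite mulr0 !add0r; congr (_ * _); apply: eqW => y' z' _ _.
  rewrite /f /push; do ! case: ifP; lia.
- move=> y' z' h1 h2; have -> : z' = t by lia.
  by rewrite ft; apply: fl.
- move=> y' z' h1 h2 y'y z't /(leftmost y'y z't ft) ->; lia.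
Qed.

Let k_gt0 : (0 < k)%N. Proof. exact: ltnW. Qed.
Let c : cell n m k := (Ordinal lt_xn, Ordinal lt_ym, Ordinal k_gt0).
Let f := fun y _ : nat => g y.

Let cf : c \in beyond n m k f. Proof. by rewrite inE /= /f gy. Qed.

Let fx : above m k f x. Proof. by move=> y' z' y'm _; apply: ge_x. Qed.

Let sum_yz0 : ~ ((y + k <= m)%N /\ flat) ->
  \sum_(B | boxes f c 1 k k B)
    partition_sum brick_weight (beyond n m k f :\: B) = 0.
Proof.
move=> nfl; apply: sum_boxes0 => //= y' z' _ h1 h2 y'y z'z ffl.
have y'E := leftmost y'y z'z (fun=> erefl) ffl; subst y'.
by apply: nfl; split=> // y' y'k; apply: (ffl y' 0); lia.
Qed.

Let sum_yz1 : (y + k <= m)%N -> flat ->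
  \sum_(B | boxes f c 1 k k B)
    partition_sum brick_weight (beyond n m k f :\: B) =
  tiling_sum (raise g y 1 k).
Proof.
move=> yk fl.
rewrite (sum_boxes1 _ _ _ _ _ (y := y) (z := 0)) /=; try lia; try done.
- by apply: eqW => y' z' _ z'k; rewrite /push /raise /f; do 2 case: ifP; lia.
- by move=> y' z' y'y _; apply: fl.
- move=> y' z' h1 h2 y'y z'z /(leftmost y'y z'z (fun=> erefl)) ->; lia.
Qed.

Let sum_xz : \sum_(B | boxes f c k 1 k B)
    partition_sum brick_weight (beyond n m k f :\: B) =
  if (x + k <= n)%N then tiling_sum (raise g y k 1) else 0.
Proof.
case: ifP => xk; last by apply: sum_boxes0 => //= y' z'; rewrite xk.
rewrite (sum_boxes1 _ _ _ _ _ (y := y) (z := 0)) /=; try lia; try done.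
- by apply: eqW => y' z' _ z'k; rewrite /push /raise /f; do 2 case: ifP; lia.
- by move=> y' z' y'y _; rewrite /f (_ : y' = y) //; lia.
Qed.

Let sum_xy0 : ~ [/\ (x + k <= n)%N, (y + k <= m)%N & flat] ->
  \sum_(B | boxes f c k k 1 B)
    partition_sum brick_weight (beyond n m k f :\: B) = 0.
Proof.
move=> nfl; apply: sum_boxes0 => //= y' z' xk h1 h2 y'y z'z ffl.
have y'E := leftmost y'y z'z (fun=> erefl) ffl; subst y'.
by apply: nfl; split=> // y' y'k; apply: (ffl y' 0); lia.
Qed.

(** The first brick gives one factor [wz], the forced rest of its stack the other [k - 1]. *)
Let sum_xy1 : (x + k <= n)%N -> (y + k <= m)%N -> flat ->
  wz * (\sum_(B | boxes f c k k 1 B)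
    partition_sum brick_weight (beyond n m k f :\: B)) =
  wz ^+ k * tiling_sum (raise g y k k).
Proof.
move=> xk yk fl.
rewrite (sum_boxes1 _ _ _ _ _ (y := y) (z := 0)) /=; try lia; try done.
- by rewrite -[k in wz ^+ k](prednK k_gt0) exprS -mulrA -subn1 -stack.
- by move=> y' z' y'y _; apply: fl.
- move=> y' z' h1 h2 y'y z'z /(leftmost y'y z'z (fun=> erefl)) ->; lia.
Qed.

Lemma tiling_sum_flat : (y + k <= m)%N -> flat ->
  tiling_sum g = wy * tiling_sum (raise g y 1 k) +
    (if (x + k <= n)%N
     then tiling_sum (raise g y k 1) + wz ^+ k * tiling_sum (raise g y k k)
     else 0).
Proof.
move=> yk fl; rewrite [LHS](W_rec cf) sum_yz1 // sum_xz -addrA.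
case: ifP => xk; first by rewrite sum_xy1.
by rewrite sum_xy0 ?mulr0 ?addr0 // xk => -[].
Qed.

Lemma tiling_sum_notflat : ~ ((y + k <= m)%N /\ flat) ->
  tiling_sum g = if (x + k <= n)%N then tiling_sum (raise g y k 1) else 0.
Proof.
move=> nfl; rewrite [LHS](W_rec cf) sum_yz0 // sum_xz sum_xy0 => [|[_ yk fl]].
  by rewrite !mulr0 add0r addr0.
by apply: nfl.
Qed.

End Step.

(** A run of fewer than [k] minimal rows between higher rows or walls has no room for width [k], so
    its rows take bricks parallel to the xz-plane one by one from the left. *)
Lemma tiling_sum_forced g x p q : (x < n)%N -> (p < q)%N -> (q <= m)%N ->
    (q < p + k)%N ->
    (forall y, (y < m)%N -> (x <= g y)%N) ->
    (forall y, (p <= y < q)%N -> g y = x) ->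
    ((0 < p)%N -> (x < g p.-1)%N) -> ((q < m)%N -> (x < g q)%N) ->
  tiling_sum g = if (x + k <= n)%N then tiling_sum (raise g p k (q - p)) else 0.
Proof.
move=> xn; move lE: (q - p)%N => l.
elim: l g p lE => [|l IHl] g p lE pq qm qpk ge_x gx gp gq; first by lia.
rewrite (@tiling_sum_notflat g x p) //; try lia; last first.
(* A window of [k] rows starting at [p] would contain the higher row [q]. *)
- by case=> pk fl; have := gq _; rewrite fl; lia.
- by apply: gx; lia.
case: ifP => // xk; have [pq1|pq1] := ltnP p.+1 q; last first.
  by apply: eq_tiling_sum => y ym; rewrite /raise; do 2 case: ifP; lia.
rewrite (IHl _ p.+1) ?xk; rewrite /raise; try lia.
- apply: eq_tiling_sum => y ym; do !case: ifP; lia.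
- by move=> y ym; have := ge_x _ ym; case: ifP; lia.
- by move=> y yq; rewrite ifF ?gx; lia.
- by rewrite ifT ?gx; lia.
- by rewrite ifF; lia.
Qed.

(** Variant that admits the empty run [p = q], given that length [k] still fits. *)
Lemma tiling_sum_forced_seg g x p q : (x < n)%N -> (x + k <= n)%N ->
    (p <= q <= m)%N -> (q < p + k)%N ->
    (forall y, (y < m)%N -> (x <= g y)%N) ->
    (forall y, (p <= y < q)%N -> g y = x) ->
    ((0 < p)%N -> (x < g p.-1)%N) -> ((q < m)%N -> (x < g q)%N) ->
  tiling_sum g = tiling_sum (raise g p k (q - p)).
Proof.
move=> xn xk /andP[]; rewrite leq_eqVlt => /predU1P[<-|pq] qm qpk ge_x gx gp gq.
  by apply: eq_tiling_sum => y _; rewrite /raise; do !case: ifP; lia.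
by rewrite (@tiling_sum_forced g x p q) // xk.
Qed.

(** The lagging profile: rows [j] to [j + k - 1] are [d] units behind the level [x]. The subtraction
    is truncated, so [d <= x] is assumed in the recurrences. *)
Definition strip (j d x : nat) : nat -> nat :=
  fun y => if (j <= y < j + k)%N then (x - d)%N else x.

Local Ltac by_profile :=
  solve [rewrite /raise /strip; intros; repeat (case: ifP => ?); lia].

(** The rows outside the window form the runs [[0, j)] and [[j + k, m)], both shorter than [k]
    because [m < 2k], hence both forced. *)
Let tiling_sum_outside g x j : (x < n)%N -> (j + k <= m)%N ->
    (forall y, (y < m)%N -> g y = x <-> ~~ (j <= y < j + k)%N) ->
    (forall y, (y < m)%N -> (x <= g y)%N) ->
  tiling_sum g = if (x + k <= n)%N then
    tiling_sum (fun y => if (j <= y < j + k)%N then g y else x + k)%N else 0.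
Proof.
move=> xn jk gx ge_x.
have gin y : (y < m)%N -> (j <= y < j + k)%N -> (x < g y)%N.
  by move=> ym yj; have := ge_x _ ym; have := gx _ ym; rewrite yj /=; lia.
have gout y : (y < m)%N -> ~~ (j <= y < j + k)%N -> g y = x.
  by move=> ym yj; apply/gx.
case: ifP => xk; last first.
  (* As [k < m], at least one of the two runs is nonempty, and it cannot be filled. *)
  have [j0|j0] := posnP j.
    rewrite (@tiling_sum_forced g x (j + k) m) ?xk //; try lia.
    - by move=> y ym; apply: gout; lia.
    - by move=> _; apply: gin; lia.
  rewrite (@tiling_sum_forced g x 0 j) ?xk //; try lia.
  - by move=> y ym; apply: gout; lia.
  - by move=> _; apply: gin; lia.
rewrite (@tiling_sum_forced_seg g x 0 j) //; try lia; first last.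
- by move=> _; apply: gin; lia.
- by move=> y ym; apply: gout; lia.
rewrite (@tiling_sum_forced_seg _ x (j + k) m) //; try lia; first last.
- by move=> _; rewrite /raise ifF; [apply: gin|]; lia.
- by move=> y ym; rewrite /raise ifF ?gout; lia.
- by move=> y ym; have := ge_x _ ym; rewrite /raise; case: ifP; lia.
apply: eq_tiling_sum => y ym; rewrite /raise.
by have := gout _ ym; do !case: ifP; lia.
Qed.

(** The strip is lowest. A brick parallel to the yz-plane reduces the lag by one; [k] bricks
    parallel to the xz-plane, or a stack, put the strip ahead, and the other rows must then advance
    by [k], restoring the lag [d]. *)
Lemma tiling_sum_strip j d x : (j + k <= m)%N -> (0 < d < k)%N ->
    (d <= x <= n)%N ->
  tiling_sum (strip j d x) = wy * tiling_sum (strip j d.-1 x) +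
    if (x + k <= n)%N then (1 + wz ^+ k) * tiling_sum (strip j d (x + k))
    else 0.
Proof.
move=> jk dk dx.
rewrite (@tiling_sum_flat _ (x - d) j) //; rewrite /strip; try lia; first last.
- by move=> y yj; rewrite ifT.
- by move=> j0; rewrite ifF; lia.
- by move=> y _; case: ifP; lia.
- by rewrite ifT; lia.
congr (wy * _ + _).
  by apply: eq_tiling_sum => y _; rewrite /raise; do !case: ifP; lia.
case: ifP => xk; last by rewrite ifF //; lia.
set g := fun y => if (j <= y < j + k)%N then _ else _.
(* One brick parallel to the xz-plane leaves [k - 1] rows of the strip, which are forced. *)
rewrite (@tiling_sum_forced_seg (raise g j k 1) (x - d) j.+1 (j + k));
  rewrite /raise /g; try by intros; do ?case: ifP; lia.
rewrite (@eq_tiling_sum _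
  (fun y => if (j <= y < j + k)%N then (x - d + k)%N else x)); last first.
  by move=> y _; do !case: ifP; lia.
rewrite (@eq_tiling_sum (fun y => if (j <= y < j + k)%N then (_ + k)%N else _)
  (fun y => if (j <= y < j + k)%N then (x - d + k)%N else x)); last first.
  by move=> y _; do !case: ifP; lia.
(* Both alternatives have reached the same profile, so their weights add up to [1 + wz ^+ k]. *)
rewrite -{1}[tiling_sum _]mul1r -mulrDl.
rewrite (@tiling_sum_outside _ x j) //; try lia; first last.
- by move=> y _; case: ifP; lia.
- by move=> y _; case: ifP; lia.
case: ifP => _; last by rewrite mulr0.
by congr (_ * _); apply: eq_tiling_sum => y _; do !case: ifP; lia.
Qed.

Lemma tiling_sum_const x : (x < n)%N ->
  tiling_sum (fun=> x) = if (x + k <= n)%N then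
    (1 + (m - k + 1)%:R * wz ^+ k) * tiling_sum (fun=> x + k)%N +
    wy * \sum_(j < m - k + 1) tiling_sum (strip j k.-1 (x + k)) else 0.
Proof.
move=> xn; case: ifP => xk; last first.
  (* Without room for length [k] only a brick parallel to the yz-plane can cover the first row, and
     the forced rows from [k] on cannot be filled. *)
  rewrite (@tiling_sum_flat _ x 0) //; try lia.
  rewrite xk addr0 (@tiling_sum_forced _ x k m) ?xk ?mulr0 //; try lia.
  - by move=> y _; rewrite /raise; case: ifP; lia.
  - by move=> y ym; rewrite /raise ifF; lia.
  - by rewrite /raise ifT; lia.
(* The profile after [i] bricks parallel to the xz-plane; row [i] is the next candidate for the
   start of a strip or stack of width [k]. *)
pose stairs i := fun y => if (y < i)%N then (x + k)%N else x.
have stairsE i : (i <= m - k + 1)%N -> tiling_sum (stairs i) =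
    tiling_sum (fun=> x + k)%N + \sum_(i <= j < m - k + 1)
      (wy * tiling_sum (strip j k.-1 (x + k)) +
       wz ^+ k * tiling_sum (fun=> x + k)%N).
  move il: (m - k + 1 - i)%N => l; elim: l i il => [|l IHl] i il im.
    (* Only [k - 1] rows remain, so they are forced. *)
    have -> : i = (m - k + 1)%N by lia.
    rewrite big_geq // addr0.
    rewrite (@tiling_sum_forced_seg _ x (m - k + 1) m) /stairs; try by_profile.
    by apply: eq_tiling_sum; by_profile.
  rewrite big_ltn; last by lia.
  rewrite (@tiling_sum_flat _ x i) /stairs; try by_profile.
  rewrite xk.
  (* Beside a strip or a stack at [i] fewer than [k] rows remain on the right, and they are
     forced. *)
  rewrite (@tiling_sum_forced_seg (raise _ i 1 k) x (i + k) m); try by_profile.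
  rewrite (@tiling_sum_forced_seg (raise _ i k k) x (i + k) m); try by_profile.
  rewrite [X in wy * X](@eq_tiling_sum _ (strip i k.-1 (x + k)));
    last by_profile.
  rewrite [X in _ + (X + _)](@eq_tiling_sum _ (stairs i.+1)); last first.
    by rewrite /stairs; by_profile.
  rewrite [X in wz ^+ k * X](@eq_tiling_sum _ (fun=> (x + k)%N));
    last by_profile.
  by rewrite IHl; [ring|lia|lia].
have -> : tiling_sum (fun=> x) = tiling_sum (stairs 0) by apply: eq_tiling_sum.
rewrite stairsE // big_mkord big_split /= -mulr_sumr sumr_const card_ord.
by rewrite -mulr_natl; ring.
Qed.

End Frontiers.

(** The recurrences determine the tiling sums. The index [a] is the length left in front of the rows
    outside the strip, which makes the value independent of [n] and [j]. *)
Lemma tiling_sum_strip_rec (n m k : nat) (R : comNzRingType) (wy wz : R)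
    (e : nat -> nat -> R) :
    (1 < k)%N -> (k < m)%N -> (m < 2 * k)%N ->
    (forall a, e 0 a = (a == 0)%:R + if (k <= a)%N then
       (1 + (m - k + 1)%:R * wz ^+ k) * e 0 (a - k)%N +
       (m - k + 1)%:R * wy * e k.-1 (a - k)%N else 0) ->
    (forall d a, (0 < d < k)%N -> e d a = wy * e d.-1 a + if (k <= a)%N then
       (1 + wz ^+ k) * e d (a - k)%N else 0) ->
  forall a d j, (d < k)%N -> (a + d <= n)%N -> (j + k <= m)%N ->
    tiling_sum n m k wy wz (strip k j d (n - a)) = e d a.
Proof.
move=> lt_1k lt_km lt_m2k e0 eS.
(* Each term on the right has smaller [a], or the same [a] and smaller [d]. *)
elim/ltn_ind => a IHa; elim=> [|d IHd] j dk adn jk.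
  rewrite (@eq_tiling_sum _ _ _ _ _ _ _ (fun=> n - a)%N); last first.
    by move=> y _; rewrite /strip subn0 if_same.
  rewrite e0; have [a0|a0] := posnP a.
    rewrite a0 tiling_sum_full => [|y _]; last by rewrite subn0.
    by rewrite ifF ?addr0 //; lia.
  rewrite add0r tiling_sum_const //; try lia.
  rewrite (_ : (n - a + k <= n)%N = (k <= a)%N); last by lia.
  case: ifP => // ka; rewrite (_ : n - a + k = n - (a - k))%N; last by lia.
  congr (_ * _ + _).
    rewrite -(IHa _ _ 0 0)%N; try lia.
    by apply: eq_tiling_sum => y _; rewrite /strip subn0 if_same.
  rewrite (eq_bigr (fun=> e k.-1 (a - k)%N)) => [|i _]; last first.
    by apply: IHa; have := ltn_ord i; lia.
  by rewrite sumr_const card_ord -[_ *+ _]mulr_natl; ring.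
rewrite eS ?dk // tiling_sum_strip //; try lia.
rewrite IHd //=; try lia.
rewrite (_ : (n - a + k <= n)%N = (k <= a)%N); last by lia.
case: ifP => // ka; rewrite (_ : n - a + k = n - (a - k))%N; last by lia.
by rewrite IHa //; lia.
Qed.

(** * Brick counts as exponents of the weights *)

Section BrickCount.
Variables (n m k : nat).
Hypotheses (lt_1k : (1 < k)%N).

Let k_gt0 : (0 < k)%N. Proof. exact: ltnW. Qed.

(** Thickness in the x-direction is 1 on one side and [k > 1] on the other; [q] and [r] cover both
    remaining orientations. *)
Lemma parallel_yz_thin q r (B : {set cell n m k}) :
  (0 < q)%N -> (0 < r)%N -> parallel_yz k B -> is_box k q r B -> False.
Proof.
move=> q0 r0 /(is_boxP _ (ltn0Sn 0) k_gt0 k_gt0)[x [y [z [hx hy hz ->]]]].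
move=> /(is_boxP _ k_gt0 q0 r0)[x' [y' [z' [hx' hy' hz' /setP E]]]].
have xn : (x' < n)%N by lia.
have xn1 : (x'.+1 < n)%N by lia.
have ym : (y' < m)%N by lia.
have zk : (z' < k)%N by lia.
have := E (Ordinal xn, Ordinal ym, Ordinal zk).
have := E (Ordinal xn1, Ordinal ym, Ordinal zk).
by rewrite !inE /=; lia.
Qed.

Lemma parallel_xz_xy (B : {set cell n m k}) :
  parallel_xz k B -> parallel_xy k B -> False.
Proof.
move=> /(is_boxP _ k_gt0 (ltn0Sn 0) k_gt0)[x [y [z [hx hy hz ->]]]].
move=> /(is_boxP _ k_gt0 k_gt0 (ltn0Sn 0))[x' [y' [z' [hx' hy' hz' /setP E]]]].
have xn : (x' < n)%N by lia.
have ym : (y' < m)%N by lia.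
have ym1 : (y'.+1 < m)%N by lia.
have zk : (z' < k)%N by lia.
have := E (Ordinal xn, Ordinal ym, Ordinal zk).
have := E (Ordinal xn, Ordinal ym1, Ordinal zk).
by rewrite !inE /=; lia.
Qed.

Variables (R : comNzRingType) (wy wz : R).

(** For [k > 1] the orientations exclude each other, so the sum of indicators is a single
    monomial. *)
Lemma brick_weightE (B : {set cell n m k}) :
  brick_weight wy wz B =
    if is_brick k B then wy ^+ parallel_yz k B * wz ^+ parallel_xy k B else 0.
Proof.
have := @parallel_yz_thin _ _ B (ltn0Sn 0) k_gt0.
have := @parallel_yz_thin _ _ B k_gt0 (ltn0Sn 0).
have := @parallel_xz_xy B.
rewrite /brick_weight /is_brick /parallel_xz /parallel_xy.
case: parallel_yz; do 2 case: is_box => //=;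
  rewrite ?mulr0n ?mulr1n ?expr1 ?expr0 ?mulr1 ?mul1r ?addr0 ?add0r //.
all: by move=> h1 h2 h3; first
  [case: (h1 isT isT) | case: (h2 isT isT) | case: (h3 isT isT)].
Qed.

Lemma prod_brick_weight (P : {set {set cell n m k}}) :
  \prod_(B in P) brick_weight wy wz B =
    if [forall B in P, is_brick k B] then
      wy ^+ #|[set B in P | parallel_yz k B]| *
      wz ^+ #|[set B in P | parallel_xy k B]|
    else 0.
Proof.
under eq_bigr do rewrite brick_weightE.
case: forall_inP => [allP|nall]; last first.
  have [B BP nB] : exists2 B, B \in P & ~~ is_brick k B.
    apply/exists_inP; rewrite -negb_forall_in; exact/forall_inP.
  by rewrite (bigD1 B) //= (negbTE nB) mul0r.
rewrite (eq_bigr (fun B => wy ^+ parallel_yz k B * wz ^+ parallel_xy k B)).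
  rewrite big_split /= -!expr_sum -!sum1dep_card.
  by congr (_ ^+ _ * _ ^+ _); rewrite -big_mkcondr.
by move=> B BP; rewrite allP.
Qed.

End BrickCount.

(** * Coefficients of formal power series *)

Section FpsCoefficients.
Variable R : comUnitRingType.
Implicit Types (f g : {fps R}) (c : R).

Lemma coef_fpsCM c f n : fpscoef (fpsC c * f) n = c * fpscoef f n.
Proof.
rewrite coef_fpsM big_ord_recl coef_fpsC subn0 big1 ?addr0 // => i _.
by rewrite coef_fpsC mul0r.
Qed.

Lemma coef_fpsXM f n :
  fpscoef (fpsX * f) n = if n is n'.+1 then fpscoef f n' else 0.
Proof.
rewrite coef_fpsM; case: n => [|n]; first by rewrite big_ord1 coef_fpsX mul0r.
rewrite 2!big_ord_recl !coef_fpsX mul0r mul1r add0r subSS subn0.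
by rewrite big1 ?addr0 // => i _; rewrite coef_fpsX mul0r.
Qed.

Lemma coef_fpsXnM k f n :
  fpscoef (fpsX ^+ k * f) n = if (k <= n)%N then fpscoef f (n - k) else 0.
Proof.
elim: k n => [|k IHk] n; first by rewrite mul1r subn0.
by rewrite exprS -mulrA coef_fpsXM; case: n => [|n] //; rewrite IHk.
Qed.

Lemma coef_fpsXn k n : fpscoef (fpsX ^+ k : {fps R}) n = (n == k)%:R.
Proof.
rewrite -[_ ^+ k]mulr1 coef_fpsXnM coef_fps1 subn_eq0 eqn_leq.
by case: (k <= n)%N; rewrite ?andbT ?andbF.
Qed.

Lemma coef_fps_sum (I : Type) (r : seq I) (P : pred I) (F : I -> {fps R}) n :
  fpscoef (\sum_(i <- r | P i) F i) n = \sum_(i <- r | P i) fpscoef (F i) n.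
Proof.
by apply: (big_morph (fun f => fpscoef f n)) => [f g|];
  rewrite ?coef_fpsD ?coef_fps0.
Qed.

Lemma fpsCM c d : fpsC (c * d) = fpsC c * fpsC d :> {fps R}.
Proof.
by apply: fpsP => n; rewrite coef_fpsCM !coef_fpsC; case: eqP; rewrite ?mulr0.
Qed.

Lemma fpsCX c n : fpsC (c ^+ n) = fpsC c ^+ n :> {fps R}.
Proof. by elim: n => // n IHn; rewrite !exprS fpsCM IHn. Qed.

Lemma fpsCD c d : fpsC (c + d) = fpsC c + fpsC d :> {fps R}.
Proof.
by apply: fpsP => n; rewrite coef_fpsD !coef_fpsC; case: eqP; rewrite ?addr0.
Qed.

Lemma fpsC_nat n : fpsC n%:R = n%:R :> {fps R}.
Proof. by elim: n => // n IHn; rewrite -!natr1 fpsCD IHn. Qed.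

Lemma fps_unit_add_XnM f g k : (0 < k)%N -> f \is a GRing.unit ->
  f + fpsX ^+ k * g \is a GRing.unit.
Proof.
by move=> k0; rewrite !fps_unitE coef_fpsD coef_fpsXnM leqNgt k0 addr0.
Qed.

End FpsCoefficients.

(** * Tiling numbers as coefficients, and the generating function *)

Lemma num_tilingsE (k m n r s : nat) : (1 < k)%N ->
  (num_tilings k m n r s)%:Z =
    fpscoef (fpscoef (tiling_sum n m k (fpsX : {fps {fps int}}) (fpsC fpsX)
                       (fun=> 0%N)) r) s.
Proof.
move=> lt_1k; rewrite /tiling_sum (_ : beyond n m k _ = setT); last first.
  by apply/setP => u; rewrite !inE.
rewrite /partition_sum !coef_fps_sum /num_tilings -natz.
rewrite -sum1_card natr_sum.
rewrite big_mkcond [RHS]big_mkcond; apply: eq_bigr => P _.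
rewrite inE /is_tiling prod_brick_weight //; case: partition => //=.
case: forallP => _ /=; last by rewrite !coef_fps0.
rewrite -fpsCX mulrC coef_fpsCM coef_fpsXn eq_sym.
case: eqP => _; last by rewrite mulr0 coef_fps0.
by rewrite mulr1 coef_fpsXn eq_sym; case: eqP.
Qed.

Theorem corollary3p4 (k m : nat) (k_gt0 : (0 < k)%N) (m_gt0 : (0 < m)%N)
    (lt_km : (k < m)%N) (lt_m2k : (m < 2 * k)%N) :
  fps3_of (fun n r s => (num_tilings k m n r s)%:Z) =
    (1 - varx ^+ k - varx ^+ k * varz ^+ k) ^+ (k - 1) /
    ((1 - varx ^+ k - (m - k + 1)%:R * varx ^+ k * varz ^+ k) *
       (1 - varx ^+ k - varx ^+ k * varz ^+ k) ^+ (k - 1)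
     - (m - k + 1)%:R * varx ^+ k * vary ^+ k).
Proof.
(* For [k = 1] no [m] satisfies [1 < m < 2]. *)
have lt_1k : (1 < k)%N by lia.
set q := 1 - varx ^+ k - varx ^+ k * varz ^+ k.
set c := (m - k + 1)%N.
set den := _ * _ - _.
(* Both [q] and [den] are rewritten as a unit plus a multiple of [varx ^+ k], hence invertible. *)
have qE : q = 1 + varx ^+ k * - (1 + varz ^+ k) by rewrite /q; ring.
have q_unit : q \is a GRing.unit by rewrite qE fps_unit_add_XnM ?unitr1.
have den_unit : den \is a GRing.unit.
  have -> : den = q ^+ (k - 1) + varx ^+ k *
      - ((1 + c%:R * varz ^+ k) * q ^+ (k - 1) + c%:R * vary ^+ k).
    by rewrite /den; ring.
  by rewrite fps_unit_add_XnM ?unitrX.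
set A := q ^+ (k - 1) / den.
(* The recurrence for [0 < d < k] reads [q * E d = vary * E d.-1]; this is its solution with
   [E 0 = A]. *)
pose E d : fps3 := vary ^+ d * A / q ^+ d.
have ES d : (0 < d)%N ->
    E d = vary * E d.-1 + varx ^+ k * ((1 + varz ^+ k) * E d).
  case: d => // d _; rewrite /=.
  have qE1 : q * E d.+1 = vary * E d.
    rewrite /E !exprS invrM ?unitrX //.
    by rewrite mulrC -!mulrA mulVr // mulr1.
  by rewrite -qE1 qE; ring.
have E0 : E 0 = 1 + varx ^+ k * ((1 + c%:R * varz ^+ k) * E 0 +
                                  c%:R * vary * E k.-1).
  have qu : q ^+ k.-1 \is a GRing.unit by rewrite unitrX.
  (* Multiplying by [q ^+ k.-1] clears the denominator of [E k.-1]; what remains is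
     [A * den = q ^+ k.-1]. *)
  apply: (mulrI qu); have EK : q ^+ k.-1 * E k.-1 = vary ^+ k.-1 * A.
    by rewrite mulrC divrK.
  have Aden : A * den = q ^+ k.-1 by rewrite divrK // subn1.
  have -> : E 0 = A by rewrite /E expr0 mul1r invr1 mulr1.
  have kE : vary ^+ k = vary * vary ^+ k.-1 by rewrite -exprS prednK.
  have -> : forall x y z u w : fps3, w * (1 + x * (y + z * u)) =
      w + x * (w * y) + x * z * (w * u) by move=> *; ring.
  by rewrite EK -{2}Aden /den subn1 kE; ring.
apply: fpsP => n; apply: fpsP => r; apply: fpsP => s /=.
rewrite num_tilingsE //; congr (fpscoef (fpscoef _ r) s).
have -> : A = E 0 by rewrite /E expr0 mul1r invr1 mulr1.
(* The empty cuboid is the profile with lag 0 at level 0, that is [a = n]. *)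
rewrite -(@tiling_sum_strip_rec n m k _ fpsX (fpsC fpsX)
  (fun d a => fpscoef (E d) a) _ _ _ _ _ n 0 0) //; try lia.
- by apply: eq_tiling_sum => y _; rewrite /strip subnn if_same.
- move=> a; rewrite {1}E0 coef_fpsD coef_fps1 coef_fpsXnM; case: ifP => // _.
  (* Factors free of x are constants of the outer series ring and pass through the coefficient of
     [varx]. *)
  have -> : (1 + c%:R * varz ^+ k : fps3) = fpsC (1 + c%:R * fpsC fpsX ^+ k).
    by rewrite fpsCD fpsCM fpsCX fpsC_nat.
  have -> : (c%:R * vary : fps3) = fpsC (c%:R * fpsX).
    by rewrite fpsCM fpsC_nat.
  by rewrite coef_fpsD !coef_fpsCM.
- move=> d a /andP[d0 _]; rewrite {1}ES // coef_fpsD coef_fpsCM coef_fpsXnM.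
  case: ifP => // _.
  have -> : (1 + varz ^+ k : fps3) = fpsC (1 + fpsC fpsX ^+ k).
    by rewrite fpsCD fpsCX.
  by rewrite coef_fpsCM.
Qed.
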